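(* Let $D\subseteq\mathbb{R}^n$ be a nonempty (possibly infinite) set of nonzero vectors contained in a linear subspace $L$ of $\mathbb{R}^n$. Then $\operatorname{pspan}(D)=L$ if and only if $\operatorname{cm}_L(D)>0$. In particular, $\operatorname{pspan}(D)=\operatorname{span}(D)$ if and only if $\operatorname{cm}_D(D)>0$.
   Context: $\operatorname{span}(D)$ is the set of finite linear combinations of elements of $D$, and $\operatorname{pspan}(D)=\{\sum_{i=1}^k\lambda_i d_i: k\in\mathbb{N}, d_i\in D,\lambda_i\ge 0\}$. For a nontrivial linear subspace $L$, the cosine measure of $D$ relative to $L$ is $$\operatorname{cm}_L(D)=\min_{u\in L,\ \|u\|=1}\ \sup_{d\in D}\frac{u^\top d}{\|d\|},$$ and $\operatorname{cm}_D(D)$ is shorthand for $\operatorname{cm}_{\operatorname{span}(D)}(D)$. *)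

(* Defs.v *)
From mathcomp Require Export all_boot all_order all_algebra.
From mathcomp Require Export all_classical all_reals all_analysis.
Export Order.TTheory GRing.Theory Num.Theory.
Export numFieldNormedType.Exports.

Set Implicit Arguments.
Unset Strict Implicit.
Unset Printing Implicit Defensive.

Global Open Scope classical_set_scope.
Global Open Scope ring_scope.

Section Definitions.
Variables (R : realType) (n : nat).
Implicit Types (D L : set 'rV[R]_n) (u v : 'rV[R]_n).

Definition dotp u v : R := \sum_i u 0 i * v 0 i.

(* The library norm `|u| on 'rV[R]_n is the max norm, not the Euclidean one. *)
Definition enorm u : R := Num.sqrt (dotp u u).

(* The library span <<X>>%VS is only defined for finite sequences X. *)
Definition linspan D : set 'rV[R]_n :=
  [set v | exists (k : nat) (c : 'I_k -> R) (d : 'I_k -> 'rV[R]_n),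
    (forall i, D (d i)) /\ v = \sum_i c i *: d i].

Definition pspan D : set 'rV[R]_n :=
  [set v | exists (k : nat) (c : 'I_k -> R) (d : 'I_k -> 'rV[R]_n),
    [/\ forall i, D (d i), forall i, 0 <= c i & v = \sum_i c i *: d i]].

Definition cosine_sup D u : R := sup [set dotp u d / enorm d | d in D].

(* The real-valued sup and inf default to 0 on unbounded or empty sets. For D
   nonempty the set below sup is nonempty and bounded (cosine_has_sup); if
   moreover L is a nontrivial linear subspace, the infimum is a minimum
   (cosine_measure_min), and linspan D is such an L as soon as D contains a
   nonzero vector (linspan_vspace). *)
Definition cosine_measure L D : R :=
  inf [set cosine_sup D u | u in [set u | L u /\ enorm u = 1]].

End Definitions.

Section Attained.
Variables (R : realType) (n : nat).
Implicit Types (D : set 'rV[R]_n) (u v d : 'rV[R]_n).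

Lemma dotp_ge0 u : 0 <= dotp u u.
Proof. by apply: sumr_ge0 => i _; rewrite -expr2 sqr_ge0. Qed.

Lemma ler_coord_enorm u i : `|u 0 i| <= enorm u.
Proof.
rewrite -sqrtr_sqr ler_sqrt ?dotp_ge0// /dotp (bigD1 i)//= -expr2 lerDl.
by apply: sumr_ge0 => j _; rewrite -expr2 sqr_ge0.
Qed.

Lemma ler_coord_norm u i : `|u 0 i| <= `|u|.
Proof. by rewrite [`|u|]mx_normrE; apply/bigmax_geP; right; exists (0, i). Qed.

Lemma dotp_enorm_le u d : `|dotp u d / enorm d| <= `|u| *+ n.
Proof.
have e0 : 0 <= enorm d by exact: sqrtr_ge0.
have [ez|enz] := eqVneq (enorm d) 0.
  by rewrite ez invr0 mulr0 normr0 mulrn_wge0.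
rewrite normrM normfV (ger0_norm e0) ler_pdivrMr ?lt_def ?enz//.
apply: (le_trans (ler_norm_sum _ _ _)).
apply: (@le_trans _ _ (\sum_(i < n) `|u| * enorm d)).
  apply: ler_sum => i _; rewrite normrM.
  by apply: ler_pM => //; [exact: ler_coord_norm|exact: ler_coord_enorm].
by rewrite sumr_const card_ord mulrnAl.
Qed.

Lemma cosine_has_sup D u : D !=set0 ->
  has_sup [set dotp u d / enorm d | d in D].
Proof.
move=> [d Dd]; split; first by exists (dotp u d / enorm d), d.
exists (`|u| *+ n) => _ [e De <-].
exact: (le_trans (ler_norm _) (dotp_enorm_le _ _)).
Qed.

Lemma dotpBl u v d : dotp (u - v) d = dotp u d - dotp v d.
Proof.
by rewrite /dotp -sumrB; apply: eq_bigr => i _; rewrite !mxE mulrBl.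
Qed.

Lemma cosine_sup_lipschitz D u v : D !=set0 ->
  cosine_sup D u - cosine_sup D v <= `|u - v| *+ n.
Proof.
move=> D0; rewrite lerBlDr; apply: ge_sup; first by case: (cosine_has_sup u D0).
move=> _ [d Dd <-].
have -> : dotp u d = dotp (u - v) d + dotp v d by rewrite dotpBl subrK.
rewrite mulrDl lerD//; first exact: (le_trans (ler_norm _) (dotp_enorm_le _ _)).
by apply: ub_le_sup; [case: (cosine_has_sup v D0)|exists d].
Qed.

Lemma cosine_sup_continuous D : D !=set0 -> continuous (cosine_sup D).
Proof.
move=> D0 u; have FF := nbhs_filter u; apply/(@cvgrPdist_lt _ R^o _ _ FF) => e e0.
near=> v.
have uv : `|u - v| *+ n < e.
  apply: (@le_lt_trans _ _ (`|u - v| *+ n.+1)); first exact: ler_wpMn2l.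
  rewrite -mulr_natr -ltr_pdivlMr ?ltr0n//.
  near: v; apply/nbhs_ballP; exists (e / n.+1%:R) => /=.
    by rewrite divr_gt0.
  by move=> v; rewrite mx_norm_ball.
apply: le_lt_trans uv; rewrite ler_norml.
have := cosine_sup_lipschitz u v D0; have := cosine_sup_lipschitz v u D0.
by rewrite distrC => h1 ->; rewrite andbT lerNl opprB.
Unshelve. all: by end_near. Qed.

Lemma cvg_sumr (T : Type) (V : normedModType R) (F : set_system T) m
    (f : 'I_m -> T -> V) (a : 'I_m -> V) : Filter F ->
  (forall i, f i x @[x --> F] --> a i) ->
  \sum_i f i x @[x --> F] --> \sum_i a i.
Proof. by move=> FF fa; apply: cvg_big => //; exact: add_continuous. Qed.

Lemma closed_vspace (L : {vspace 'rV[R]_n}) : closed [set` L].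
Proof.
pose g u : 'rV[R]_n := \sum_i u 0 i *: (delta_mx 0 i - projv L (delta_mx 0 i)).
have gE u : g u = u - projv L u.
  rewrite {2 3}(row_sum_delta u) linear_sum -sumrB.
  by apply: eq_bigr => i _; rewrite linearZ scalerBr.
have -> : [set` L] = g @^-1` [set 0].
  apply/seteqP; split => u /=; rewrite gE.
    by move=> uL; rewrite projv_id// subrr.
  by move=> /subr0_eq ->; exact: memv_proj.
apply: preimage_closed; last first.
  by apply: accessible_closed_set1; exact/hausdorff_accessible/norm_hausdorff.
move=> u _; have FF := nbhs_filter u.
apply: (@cvg_sumr _ 'rV[R]_n (nbhs u) _
  (fun i v => v 0 i *: (delta_mx 0 i - projv L (delta_mx 0 i)))
  (fun i => u 0 i *: (delta_mx 0 i - projv L (delta_mx 0 i))) FF) => i.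
exact: (@cvgZr_tmp R 'rV[R]_n _ (nbhs u) FF (fun v => v 0 i) (u 0 i) _
  (@coord_continuous R 1 n 0 i u)).
Qed.

Lemma dotp_continuous : continuous (fun u => dotp u u).
Proof.
move=> u; have FF := nbhs_filter u.
apply: (@cvg_sumr _ R^o (nbhs u) _
  (fun i v => v 0 i * v 0 i) (fun i => u 0 i * u 0 i) FF) => i.
have cu := @coord_continuous R 1 n 0 i u; exact: (cvgM cu cu).
Qed.

Lemma cosine_measure_min (L : {vspace 'rV[R]_n}) D :
  L != 0%VS -> D !=set0 ->
  exists u, [/\ u \in L, enorm u = 1, cosine_measure [set` L] D = cosine_sup D u
    & forall v, v \in L -> enorm v = 1 -> cosine_sup D u <= cosine_sup D v].
Proof.
move=> L0 D0; set A : set 'rV[R]_n := [set u | [set` L] u /\ enorm u = 1].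
have A0 : A !=set0.
  have w0 : vpick L != 0 by rewrite vpick0.
  have e0 : enorm (vpick L) != 0.
    apply: contra w0 => /eqP ez; apply/eqP/rowP => i; rewrite mxE.
    by apply/eqP; rewrite -normr_le0 -ez ler_coord_enorm.
  exists ((enorm (vpick L))^-1 *: vpick L); split => /=.
    by rewrite memvZ// memv_pick.
  rewrite /enorm; set w := vpick L.
  have -> c : dotp (c *: w) (c *: w) = c ^+ 2 * dotp w w.
    rewrite /dotp mulr_sumr; apply: eq_bigr => i _.
    by rewrite !mxE mulrACA expr2.
  by rewrite sqrtrM ?sqr_ge0// sqrtr_sqr ger0_norm ?invr_ge0 ?sqrtr_ge0// mulVf.
have cA : compact A.
  apply: bounded_closed_compact.
    exists 1; split; first exact: num_real.
    move=> M M1 u [_ u1] /=; rewrite [`|u|]mx_normrE.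
    apply/bigmax_leP; split; first by rewrite ltW// (lt_trans _ M1).
    move=> [j i] _ /=; rewrite ord1 (le_trans (ler_coord_enorm u i))// u1.
    exact: ltW.
  have -> : A = [set` L] `&` (@enorm R n @^-1` [set 1]) by [].
  apply: closedI; first exact: closed_vspace.
  apply: preimage_closed; last first.
    by apply: accessible_closed_set1; exact/hausdorff_accessible/norm_hausdorff.
  move=> u _; apply: (@continuous_comp _ _ _ (fun u => dotp u u) Num.sqrt).
    exact: dotp_continuous.
  exact: sqrt_continuous.
have [u uA umin] := @compact_EVT_min _ R (cosine_sup D) A A0 cA
  (continuous_subspaceT (cosine_sup_continuous D0)).
move: uA; rewrite inE => -[uL u1].
have umin' v : v \in L -> enorm v = 1 -> cosine_sup D u <= cosine_sup D v.
  by move=> vL v1; apply: umin; rewrite inE.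
exists u; split => //; apply/eqP; rewrite eq_le; apply/andP; split.
  apply: ge_inf; last by exists u.
  by exists (cosine_sup D u) => _ [v [vL v1] <-]; exact: umin'.
apply: lb_le_inf; first by exists (cosine_sup D u), u.
by move=> _ [v [vL v1] <-]; exact: umin'.
Qed.

Lemma linspan_vspace D : exists L : {vspace 'rV[R]_n}, [set` L] = linspan D.
Proof.
pose P k := `[< exists2 X : seq 'rV[R]_n,
  (forall x, x \in X -> D x) & \dim <<X>>%VS = k >].
have exP : exists k, P k.
  by exists (\dim <<[::] : seq 'rV[R]_n>>%VS); apply/asboolP; exists [::].
have bP k : P k -> (k <= \dim (fullv : {vspace 'rV[R]_n}))%N.
  by move=> /asboolP[X _ <-]; rewrite dimvS// subvf.
case: (ex_maxnP exP bP) => k /asboolP[X sD sk] kmax.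
exists <<X>>%VS; apply/seteqP; split => v /=.
  move=> vs; exists (size X), (fun i => coord (in_tuple X) i v).
  exists (fun i => X`_i); split; last exact: (@coord_span _ _ _ (in_tuple X)).
  by move=> i; apply: sD; rewrite mem_nth.
move=> [m [c [d [dD ->]]]]; apply: memv_suml => i _; apply: memvZ.
have sub : (<<X>> <= <<(d i :: X)%SEQ>>)%VS by rewrite span_cons addvSr.
have /eqP -> : <<X>>%VS == <<(d i :: X)%SEQ>>%VS.
  rewrite eqEdim sub sk; apply: kmax; apply/asboolP; exists (d i :: X) => //.
  by move=> x; rewrite inE => /predU1P[->//|]; exact: sD.
by rewrite memv_span// mem_head.
Qed.

End Attained.

(* Main.v *)
Require Import Defs.
From mathcomp Require Import ring lra.

(** If pspan D = L, a unit vector u of L minimising the cosine is itself a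
    nonnegative combination of vectors of D; since u.u = 1 > 0, one of these
    vectors makes a positive product with u, so the minimum is positive.

    Conversely let a be positive and below the cosine measure. For any v in L
    and p in pspan D, the residual r = v - p makes with some d in D an angle of
    cosine more than a, so adding to p the projection of r on d, which is a
    nonnegative multiple of d, multiplies the squared residual by at most
    1 - a^2. The infimum
    of the squared residuals over pspan D is therefore 0, which says that
    pspan D is dense in L ([cosine_measure_gt0_dense]).

    For infinite D the cone pspan D need not be closed a priori, but a convex
    cone dense in a finite-dimensional space L is all of L ([dense_cone_full]).
    This goes by induction on the dimension of L: the cone meets both sides of
    a hyperplane H of L, and density of K in L yields density of the cone
    K cap H in H, because an approximation of a point of H can be pushed into
    H by adding a small element of K. So K contains H, and points on both sides
    of it, hence L.

    The second equivalence is the first one for L the span of D. *)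

Set Implicit Arguments.
Unset Strict Implicit.
Unset Printing Implicit Defensive.

(** * The Euclidean inner product *)

Section InnerProduct.
Variables (R : realType) (n : nat).
Implicit Types u v w x r d : 'rV[R]_n.

Lemma dotpC u v : dotp u v = dotp v u.
Proof. by apply: eq_bigr => i _; rewrite mulrC. Qed.

Lemma dotpDl u v w : dotp (u + v) w = dotp u w + dotp v w.
Proof. by rewrite /dotp -big_split; apply: eq_bigr => i _; rewrite !mxE mulrDl. Qed.

Lemma dotpZl a u v : dotp (a *: u) v = a * dotp u v.
Proof. by rewrite /dotp mulr_sumr; apply: eq_bigr => i _; rewrite mxE mulrA. Qed.

Lemma dotp0l v : dotp 0 v = 0.
Proof. by rewrite -(scale0r v) dotpZl mul0r. Qed.

Lemma dotp_suml k (f : 'I_k -> 'rV[R]_n) v :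
  dotp (\sum_i f i) v = \sum_i dotp (f i) v.
Proof.
by rewrite (big_morph (fun x => dotp x v) (fun x y => dotpDl x y v) (dotp0l v)).
Qed.

Lemma dotp_mulmx u v : u *m v^T = (dotp u v)%:M.
Proof.
apply/matrixP => i j; rewrite !ord1 !mxE eqxx mulr1n.
by apply: eq_bigr => k _; rewrite mxE.
Qed.

Lemma sqr_enorm u : enorm u ^+ 2 = dotp u u.
Proof. by rewrite sqr_sqrtr ?dotp_ge0. Qed.

Lemma ler_norm_enorm u : `|u| <= enorm u.
Proof.
rewrite [`|u|]mx_normrE; apply/bigmax_leP; split; first exact: sqrtr_ge0.
by move=> [j i] _ /=; rewrite ord1 ler_coord_enorm.
Qed.

Lemma enorm_gt0 u : (0 < enorm u) = (u != 0).
Proof.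
apply/idP/idP => [|u0]; last first.
  by rewrite (lt_le_trans _ (ler_norm_enorm u))// normr_gt0.
by apply: contraTneq => ->; rewrite /enorm dotp0l sqrtr0 ltxx.
Qed.

Lemma dotp_gt0 u : (0 < dotp u u) = (u != 0).
Proof. by rewrite -sqrtr_gt0 enorm_gt0. Qed.

(** Continuity of x |-> x.w, in the form used below; C is kept positive, even
    for w = 0, so that one can divide by it. *)
Lemma dotp_bounded w : exists2 C : R, 0 < C & forall x, `|dotp x w| <= C * `|x|.
Proof.
have e0 : 0 <= enorm w by exact: sqrtr_ge0.
exists (1 + enorm w *+ n) => [|x].
  by rewrite ltr_wpDr// mulrn_wge0// sqrtr_ge0.
have [->|w0] := eqVneq w 0.
  by rewrite dotpC dotp0l normr0 mulr_ge0// addr_ge0// mulrn_wge0// sqrtr_ge0.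
have := dotp_enorm_le x w; rewrite normrM normfV (ger0_norm e0).
rewrite ler_pdivrMr ?enorm_gt0// => /le_trans; apply.
by rewrite mulrDl mul1r mulrnAl mulrnAl [_ * enorm w]mulrC lerDr.
Qed.

(** Pythagoras: what subtracting the projection of r on d gains in squared
    length is governed by the cosine between r and d. *)
Lemma dotp_sub_proj r d : d != 0 ->
  dotp (r - (dotp r d / dotp d d) *: d) (r - (dotp r d / dotp d d) *: d) =
  dotp r r - (dotp r d / enorm d) ^+ 2.
Proof.
rewrite -dotp_gt0 => /lt0r_neq0 d0.
rewrite dotpBl dotpZl dotpC dotpBl dotpZl.
rewrite [dotp d (r - _)]dotpC dotpBl dotpZl [dotp d r]dotpC.
by rewrite exprMn exprVn sqr_enorm; field.
Qed.

End InnerProduct.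

(** * Dense convex cones *)

Section DenseCone.
Variables (R : realType) (n : nat).
Implicit Types (K : set 'rV[R]_n) (L : {vspace 'rV[R]_n}) (w x k : 'rV[R]_n).

Definition convex_cone K :=
  [/\ K 0, forall x y, K x -> K y -> K (x + y)
    & forall a x, 0 <= a -> K x -> K (a *: x)].

(** The norm here is the max norm of the library, for which the triangle
    inequality and scaling come for free; in finite dimension it defines the
    same density as the Euclidean one. *)
Definition dense_in K L :=
  forall x, x \in L -> forall e, 0 < e -> exists2 k, K k & `|x - k| < e.

(** By density K contains a point a close to w and a point b close to - w, so
    that a.w > 0 > b.w. Their nonnegative multiples then realise every value of
    x |-> x.w inside K, at a cost linear in that value. *)
Lemma dense_cone_section K L w : convex_cone K -> dense_in K L ->
  w \in L -> w != 0 ->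
  exists2 B : R, 0 <= B &
    forall t, exists c, [/\ K c, dotp c w = t & `|c| <= B * `|t|].
Proof.
move=> [_ _ KZ] dK wL w0; have [C C0 Cw] := dotp_bounded w.
have qw : 0 < dotp w w by rewrite dotp_gt0.
(* At this distance a perturbation changes the product with w by less than
   w.w, which keeps the signs of a.w and b.w. *)
have e0 : 0 < dotp w w / C by exact: divr_gt0.
have [a Ka aw] := dK _ wL _ e0.
have [b Kb bw] := dK (- w) ltac:(by rewrite memvN) _ e0.
have near x : `|x| < dotp w w / C -> `|dotp x w| < dotp w w.
  move=> xC; apply: (le_lt_trans (Cw x)).
  by rewrite mulrC -ltr_pdivlMr.
have fa : 0 < dotp a w.
  move: (near _ aw); rewrite dotpBl ltr_norml => /andP[_].
  by rewrite ltrBlDr ltrDl.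
have fb : dotp b w < 0.
  move: (near _ bw); rewrite dotpBl -scaleN1r dotpZl mulN1r ltr_norml.
  by move=> /andP[+ _]; rewrite ltrDl oppr_gt0.
exists (`|a| / dotp a w + `|b| / - dotp b w) => [|t].
  by rewrite addr_ge0// divr_ge0// ?oppr_ge0 ltW.
have [t0|t0] := leP 0 t.
  exists ((t / dotp a w) *: a); split.
  - by apply: KZ => //; rewrite divr_ge0// ltW.
  - by rewrite dotpZl divfK ?gt_eqF.
  - rewrite normrZ normrM normfV (gtr0_norm fa) mulrDl mulrAC -mulrA mulrC.
    by rewrite mulrAC lerDl mulr_ge0// divr_ge0// oppr_ge0 ltW.
exists ((t / dotp b w) *: b); split.
- by apply: KZ => //; rewrite -mulrNN -invrN divr_ge0// oppr_ge0 ltW.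
- by rewrite dotpZl divfK ?lt_eqF.
- rewrite normrZ normrM normfV (ltr0_norm fb) mulrDl -[X in X <= _]mulrC mulrA.
  by rewrite mulrAC lerDr mulr_ge0// divr_ge0// ltW.
Qed.

(** The point is to descend to the hyperplane H of L orthogonal to a vector
    w of L: an approximation k in K of h in H misses H by (h - k).w, which is
    small, and adding the element of K supplied by [dense_cone_section] for
    this value lands in H without spoiling the approximation. *)
Lemma dense_cone_full K L : convex_cone K -> K `<=` [set` L] ->
  dense_in K L -> [set` L] `<=` K.
Proof.
have [m] := ubnP (\dim L); elim: m => // m IH in K L *.
rewrite ltnS => Lm cK KL dK; have [K0 KD KZ] := cK.
have [->|L0] := eqVneq L 0%VS; first by move=> x /=; rewrite memv0 => /eqP ->.
have wL := memv_pick L; have w0 : vpick L != 0 by rewrite vpick0.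
set w := vpick L in wL w0.
have [C C0 Cw] := dotp_bounded w.
have [B B0 sec] := dense_cone_section cK dK wL w0.
pose H := (L :&: lker (linfun (mulmxr w^T)))%VS.
have HE x : (x \in H) = (x \in L) && (dotp x w == 0).
  rewrite memv_cap memv_ker lfunE/= dotp_mulmx.
  congr (_ && _); apply/eqP/eqP => [/matrixP/(_ 0 0)|->]; last exact: raddf0.
  by rewrite !mxE eqxx mulr1n.
have HL : (\dim H < m)%N.
  apply: leq_trans Lm; rewrite ltnNge; apply/negP => LH.
  have HeqL : H == L by rewrite eqEdim capvSl.
  by move: wL; rewrite -(eqP HeqL) HE => /andP[_]; rewrite gt_eqF// dotp_gt0.
have HK : [set` H] `<=` K `&` [set` H].
  apply: IH => //.
  - split; first by split=> //=; rewrite mem0v.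
    + by move=> x y [? ?] [? ?]; split; [exact: KD|exact: memvD].
    + by move=> a x a0 [? ?]; split; [exact: KZ|exact: memvZ].
  - move=> h; rewrite HE => /andP[hL /eqP hw] e e0.
    (* Correcting k costs at most B * C times its distance to h. *)
    have M0 : 0 < 1 + B * C by rewrite ltr_wpDr// mulr_ge0// ltW.
    have [k Kk hk] := dK _ hL _ (divr_gt0 e0 M0).
    have [c [Kc cw cB]] := sec (dotp (h - k) w).
    exists (k + c).
      split; first exact: KD.
      by rewrite /= HE memvD ?KL//= dotpDl cw dotpBl hw sub0r subrr.
    rewrite opprD addrA (le_lt_trans (ler_normB _ _))//.
    rewrite ltr_pdivlMr// in hk; apply: le_lt_trans hk.
    have := ler_wpM2l B0 (Cw (h - k)); lra.
(* Removing from x an element of K with the same product with w leaves a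
   vector of H, which is in K. *)
move=> x /= xL; have [c [Kc cw _]] := sec (dotp x w).
rewrite -(subrK c x); apply: KD => //.
have /HK[]// : [set` H] (x - c).
by rewrite /= HE (memvB xL (KL _ Kc))/= dotpBl cw subrr.
Qed.

End DenseCone.

(** * Positive spans and the cosine measure *)

Section PositiveSpan.
Variables (R : realType) (n : nat).
Implicit Types (D : set 'rV[R]_n) (L : {vspace 'rV[R]_n}) (u v d : 'rV[R]_n).

Lemma pspan_convex_cone D : convex_cone (pspan D).
Proof.
split.
- by exists 0%N, (fun=> 0), (fun=> 0); split=> [[]|[]|] //; rewrite big_ord0.
- move=> _ _ [k [c [d [dD c0 ->]]]] [l [b [e [eD b0 ->]]]].
  exists (k + l)%N.
  exists (fun i => match fintype.split i with inl j => c j | inr j => b j end).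
  exists (fun i => match fintype.split i with inl j => d j | inr j => e j end).
  split=> [i|i|]; try by case: (fintype.split i).
  rewrite big_split_ord/=; congr (_ + _); apply: eq_bigr => i _.
    by rewrite (unsplitK (inl i)).
  by rewrite (unsplitK (inr i)).
- move=> a _ a0 [k [c [d [dD c0 ->]]]]; exists k, (fun i => a * c i), d.
  split=> // [i|]; first exact: mulr_ge0.
  by rewrite scaler_sumr; apply: eq_bigr => i _; rewrite scalerA.
Qed.

Lemma sub_pspan D : D `<=` pspan D.
Proof.
move=> d Dd; exists 1%N, (fun=> 1), (fun=> d); split => //.
by rewrite big_ord1 scale1r.
Qed.

Lemma sub_linspan D : D `<=` linspan D.
Proof.
move=> d Dd; exists 1%N, (fun=> 1), (fun=> d); split => //.
by rewrite big_ord1 scale1r.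
Qed.

Lemma pspan_sub_vspace L D : D `<=` [set` L] -> pspan D `<=` [set` L].
Proof.
by move=> DL _ [k [c [d [dD _ ->]]]] /=; apply: memv_suml => i _; exact/memvZ/DL.
Qed.

Lemma pspan_dotp_gt0 D u : pspan D u -> u != 0 -> exists2 d, D d & 0 < dotp u d.
Proof.
move=> [k [c [d [dD c0 uE]]]] u0; apply: contrapT => noD.
have : 0 < dotp u u by rewrite dotp_gt0.
rewrite {1}uE dotp_suml ltNge => /negP; apply; apply: sumr_le0 => i _.
rewrite dotpZl mulr_ge0_le0// dotpC leNgt; apply/negP => ud.
by apply: noD; exists (d i).
Qed.

Lemma cosine_sup_gt0 D u d : D d -> 0 < dotp u d -> 0 < cosine_sup D u.
Proof.
move=> Dd ud; apply: (@lt_le_trans _ _ (dotp u d / enorm d)).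
  rewrite divr_gt0// enorm_gt0; apply: contraTneq ud => ->.
  by rewrite dotpC dotp0l ltxx.
apply: ub_le_sup; last by exists d.
by have [] : has_sup [set dotp u d / enorm d | d in D]
  by apply: cosine_has_sup; exists d.
Qed.

(** The definition of the cosine measure speaks of unit vectors and of a
    supremum that need not be attained; this is the homogeneous form, for which
    a strict inequality a < cm is needed. *)
Lemma cosine_measure_direction L D a r : L != 0%VS -> D !=set0 ->
  a < cosine_measure [set` L] D -> r \in L -> r != 0 ->
  exists2 d, D d & a * enorm r < dotp r d / enorm d.
Proof.
move=> L0 D0 aD rL r0; have er : 0 < enorm r by rewrite enorm_gt0.
have [u [_ _ cmE umin]] := cosine_measure_min L0 D0.
pose v := (enorm r)^-1 *: r.
have v1 : enorm v = 1.
  rewrite /enorm dotpZl dotpC dotpZl -sqr_enorm mulrA -expr2 -exprMn.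
  by rewrite mulVf ?gt_eqF// expr1n sqrtr1.
have av : a < cosine_sup D v.
  by rewrite (lt_le_trans aD)// cmE umin// memvZ.
have D0v : [set dotp v d / enorm d | d in D] !=set0.
  by case: D0 => d Dd; exists (dotp v d / enorm d), d.
have [_ [d Dd <-] ad] := sup_gt D0v av.
exists d => //; move: ad; rewrite /v dotpZl -mulrA => ad.
by rewrite -ltr_pdivlMr// mulrC.
Qed.

(** Fix v and let m be the infimum of the squared residuals |v - p|^2 over p in
    pspan D. One greedy step bounds m by c |v - p|^2 for every p, with c < 1
    independent of p, so m <= c m and m = 0. *)
Lemma cosine_measure_gt0_dense L D : L != 0%VS -> D !=set0 ->
  (forall d, D d -> d != 0) -> D `<=` [set` L] ->
  0 < cosine_measure [set` L] D -> dense_in (pspan D) L.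
Proof.
move=> L0 D0 Dn0 DL cm0 v vL e e0.
have [P0 PD PZ] := pspan_convex_cone D.
(* Any a strictly between 0 and the cosine measure would do. *)
have a0 : 0 < cosine_measure [set` L] D / 2 by rewrite divr_gt0.
have acm : cosine_measure [set` L] D / 2 < cosine_measure [set` L] D by lra.
set a := cosine_measure _ _ / 2 in a0 acm.
pose c := 1 - a ^+ 2.
have c1 : c < 1 by rewrite /c ltrBlDr ltrDl exprn_gt0.
pose S := [set dotp (v - p) (v - p) | p in pspan D].
have S0 : S !=set0 by exists (dotp (v - 0) (v - 0)), 0.
have Sge0 : lbound S 0 by move=> _ [p _ <-]; exact: dotp_ge0.
have m0 : 0 <= inf S by exact: lb_le_inf.
have contract p : pspan D p -> inf S <= c * dotp (v - p) (v - p).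
  move=> Dp; have rL : v - p \in L by rewrite memvB//; exact: (pspan_sub_vspace DL).
  have [rz|r0] := eqVneq (v - p) 0.
    rewrite rz dotp0l mulr0 -(dotp0l (0 : 'rV[R]_n)) -rz.
    by apply: ge_inf; [exists 0|exists p].
  (* The greedy step: project the residual on a direction of D almost aligned
     with it. *)
  have [d Dd ad] := cosine_measure_direction L0 D0 acm rL r0.
  have d0 := Dn0 _ Dd; set r := v - p in rL r0 ad *.
  have t0 : 0 <= dotp r d / dotp d d.
    rewrite divr_ge0 ?dotp_ge0// ltW//.
    have : 0 < dotp r d / enorm d.
      by apply: lt_trans ad; rewrite mulr_gt0// enorm_gt0.
    by rewrite pmulr_lgt0// invr_gt0 enorm_gt0.
  apply: (@le_trans _ _ (dotp r r - (dotp r d / enorm d) ^+ 2)).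
    rewrite -(dotp_sub_proj r d0); apply: ge_inf; first by exists 0.
    exists (p + (dotp r d / dotp d d) *: d); last by rewrite opprD addrA.
    by apply: PD => //; apply: PZ => //; exact: sub_pspan.
  rewrite /c mulrBl mul1r lerD2l lerN2 -sqr_enorm -exprMn ler_sqr ?nnegrE.
  - exact: ltW.
  - by rewrite mulr_ge0 ?sqrtr_ge0// ltW.
  - by apply: ltW; apply: le_lt_trans ad; rewrite mulr_ge0 ?sqrtr_ge0// ltW.
have mz : inf S = 0.
  apply: contrapT => /eqP mn0.
  have {mn0} mgt0 : 0 < inf S by rewrite lt_def mn0.
  have cgt0 : 0 < c.
    have := lt_le_trans mgt0 (contract 0 P0).
    by rewrite pmulr_lgt0//; apply: (lt_le_trans mgt0); apply: ge_inf;
      [exists 0|exists 0].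
  have : inf S / c <= inf S.
    apply: lb_le_inf => // _ [p Dp <-].
    by rewrite ler_pdivrMr// mulrC contract.
  by rewrite ler_pdivrMr// ler_pMr// leNgt c1.
have [_ [p Dp <-]] := inf_adherent (exprn_gt0 2 e0) (conj S0 (ex_intro _ 0 Sge0)).
have r0 : 0 <= enorm (v - p) by exact: sqrtr_ge0.
rewrite mz add0r -sqr_enorm ltr_sqr ?nnegrE ?(ltW e0)// => pe.
by exists p => //; exact: le_lt_trans (ler_norm_enorm _) pe.
Qed.

Lemma pspan_vspaceP L D : D !=set0 -> (forall d, D d -> d != 0) ->
  D `<=` [set` L] -> pspan D = [set` L] <-> 0 < cosine_measure [set` L] D.
Proof.
move=> D0 Dn0 DL; have L0 : L != 0%VS.
  case: D0 => d Dd; apply: contra (Dn0 _ Dd) => /eqP Lz.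
  by have := DL _ Dd; rewrite /= Lz memv0.
split=> [DE|cm0].
  have [u [uL u1 -> _]] := cosine_measure_min L0 D0.
  have [d Dd ud] : exists2 d, D d & 0 < dotp u d.
    by apply: pspan_dotp_gt0; [rewrite DE|rewrite -enorm_gt0 u1].
  exact: cosine_sup_gt0 ud.
apply/seteqP; split; first exact: pspan_sub_vspace.
apply: dense_cone_full; [exact: pspan_convex_cone|exact: pspan_sub_vspace|].
exact: cosine_measure_gt0_dense.
Qed.

End PositiveSpan.

Theorem proposition22 (R : realType) (n : nat) (L : {vspace 'rV[R]_n})
    (D : set 'rV[R]_n) (D_nonempty : D !=set0)
    (D_nonzero : forall d, D d -> d != 0) (D_sub_L : D `<=` [set` L]) :
  (pspan D = [set` L] <-> 0 < cosine_measure [set` L] D) /\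
  (pspan D = linspan D <-> 0 < cosine_measure (linspan D) D).
Proof.
split; first exact: pspan_vspaceP.
have [M ME] := linspan_vspace D; rewrite -ME; apply: pspan_vspaceP => //.
by rewrite ME; exact: sub_linspan.
Qed.
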